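(* Let $Z$ be a $d$-dimensional lattice zonotope in $\mathbb{R}^d$ and let $p$ be a positive integer. If $\delta(H_1(d,p))\leq\delta(Z)$, then $k(H_1(d,p))\leq k(Z)$. If moreover $\delta(H_1(d,p))<\delta(Z)$, then $k(H_1(d,p))<k(Z)$. If $\delta(H_1(d,p))=\delta(Z)$ and $k(H_1(d,p))=k(Z)$, then $Z$ is a translate of $H_1(d,p)$.
   Context: A lattice polytope in $\mathbb{R}^d$ is a polytope with all vertices in $\mathbb{Z}^d$. A zonotope is a Minkowski sum of finitely many pairwise non-collinear line segments; a lattice zonotope is a zonotope that is a lattice polytope. A point of $\mathbb{Z}^d$ is primitive if it is nonzero and the gcd of its coordinates is $1$. For a positive integer $p$, $H_1(d,p)$ is the zonotope $\sum_x[0,x]$, where $x$ ranges over all primitive points of $\mathbb{Z}^d$ with $\|x\|_1\leq p$ whose first nonzero coordinate is positive. For a polytope $P$, $\delta(P)$ is the diameter of its graph (vertices and edges). For a $d$-dimensional lattice polytope $P$, $k(P)$ is the smallest integer $k$ such that some translate of $P$ by a vector of $\mathbb{Z}^d$ is contained in $[0,k]^d$. *)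

(* Defs.v *)
From HB Require Import structures.
From mathcomp Require Import all_boot all_order all_algebra.
From mathcomp Require Import boolp classical_sets functions cardinality fsbigop.
From mathcomp Require Import reals.

Set Implicit Arguments.
Unset Strict Implicit.
Unset Printing Implicit Defensive.

Import Order.TTheory GRing.Theory Num.Theory.

Local Open Scope classical_set_scope.
Local Open Scope ring_scope.

Section Polytopes.
Context {R : realType} {d : nat}.
Implicit Types (A P F Z : set 'rV[R]_d) (a b u v : 'rV[R]_d).

Definition dot u v : R := \sum_(i < d) u ord0 i * v ord0 i.

Definition affine_hull A : set 'rV[R]_d :=
  [set y | exists n (w : 'I_n -> R) (x : 'I_n -> 'rV[R]_d),
     [/\ forall i, A (x i), \sum_i w i = 1 & y = \sum_i w i *: x i]].

Definition convex_hull A : set 'rV[R]_d :=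
  [set y | exists n (w : 'I_n -> R) (x : 'I_n -> 'rV[R]_d),
     [/\ forall i, A (x i), forall i, 0 <= w i,
         \sum_i w i = 1 & y = \sum_i w i *: x i]].

Definition has_dim A (k : nat) : Prop :=
  exists (x0 : 'rV[R]_d) (U : {vspace 'rV[R]_d}),
    \dim U = k /\ affine_hull A = [set x0 + u | u in [set u | u \in U]].

Definition segment a b : set 'rV[R]_d :=
  [set (1 - t) *: a + t *: b | t in [set t : R | 0 <= t <= 1]].

Definition translate u A : set 'rV[R]_d := [set u + x | x in A].

(* Meaningful when [D] is finite, or more generally when every selection [f]
   vanishes at all but finitely many indices of [D]. *)
Definition minkowski_sum (I : choiceType) (D : set I) (S : I -> set 'rV[R]_d) :
    set 'rV[R]_d :=
  [set y | exists2 f : I -> 'rV[R]_d,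
     (forall i, D i -> S i (f i)) & y = \sum_(i \in D) f i].

Definition polytope P : Prop :=
  exists2 V : set 'rV[R]_d, finite_set V & P = convex_hull V.

(* [c = 0] gives the improper faces [P] and [set0]. *)
Definition face P F : Prop :=
  exists (c : 'rV[R]_d) (b : R),
    (forall x, P x -> dot c x <= b) /\ F = P `&` [set x | dot c x = b].

Definition vertex P v : Prop := face P [set v].

Definition edge P F : Prop := face P F /\ has_dim F 1.

Definition adjacent P u v : Prop :=
  [/\ vertex P u, vertex P v & edge P (segment u v)].

Definition walk P u v (n : nat) : Prop :=
  exists s : seq 'rV[R]_d,
    [/\ path (fun x y => `[< adjacent P x y >]) u s, last u s = v & size s = n].

Definition graph_dist P u v (n : nat) : Prop :=
  walk P u v n /\ forall m, walk P u v m -> (n <= m)%N.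

Definition is_diameter P (n : nat) : Prop :=
  (forall u v, vertex P u -> vertex P v ->
     exists2 m, graph_dist P u v m & (m <= n)%N) /\
  (exists u v, [/\ vertex P u, vertex P v & graph_dist P u v n]).

(* [is_diameter P] is satisfied by at most one integer, and by one whenever [P]
   is a nonempty polytope; 0 is a junk value for other sets. *)
Definition diameter P : nat := xget 0%N (is_diameter P).

Definition lattice_point (z : 'rV[int]_d) : 'rV[R]_d := map_mx intr z.

Definition lattice_polytope P : Prop :=
  polytope P /\ forall v, vertex P v -> exists z, v = lattice_point z.

(* Segments are non-collinear when their directions are linearly independent:
   parallel segments on distinct lines count as collinear. *)
Definition zonotope Z : Prop :=
  exists (n : nat) (a b : 'I_n -> 'rV[R]_d),
    [/\ forall i, a i != b i,
        forall i j, i != j -> free [:: b i - a i; b j - a j] &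
        Z = minkowski_sum [set: 'I_n] (fun i => segment (a i) (b i))].

Definition lattice_zonotope Z : Prop := zonotope Z /\ lattice_polytope Z.

Definition fits_in_box P (k : int) : Prop :=
  exists z : 'rV[int]_d, forall x, translate (lattice_point z) P x ->
    forall i, 0 <= x ord0 i <= k%:~R.

Definition is_box_size P (k : int) : Prop :=
  fits_in_box P k /\ forall l, fits_in_box P l -> k <= l.

(* k(P); 0 is a junk value for sets without a least such integer, which for
   [0 < d] are the empty set and the unbounded sets. *)
Definition box_size P : int := xget 0 (is_box_size P).

Definition primitive (z : 'rV[int]_d) : Prop :=
  z != 0 /\ \big[gcdn/0%N]_(i < d) `|z ord0 i|%N = 1%N.

Definition norm1 (z : 'rV[int]_d) : int := \sum_(i < d) `|z ord0 i|.

Definition first_nonzero_pos (z : 'rV[int]_d) : Prop :=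
  exists i : 'I_d,
    0 < z ord0 i /\ forall j : 'I_d, (j < i)%N -> z ord0 j = 0.

Definition H1_generators (p : nat) : set 'rV[int]_d :=
  [set z | [/\ primitive z, norm1 z <= p%:Z & first_nonzero_pos z]].

End Polytopes.

Definition H1 (R : realType) (d p : nat) : set 'rV[R]_d :=
  minkowski_sum (H1_generators p) (fun z => segment 0 (lattice_point z)).

Arguments H1 R d p : clear implicits.

(* Main.v *)
(** The vertex of a zonotope that maximises a generic linear functional [c] is
   determined by the set of generators on which [c] is positive, and crossing an
   edge flips exactly one generator.  Opposite vertices differ on every generator,
   so the diameter is the number of generators.  Each generator is a difference of
   two vertices, hence integral for a lattice zonotope; the box size is then the
   largest of the [d] coordinate widths, and [d * k(Z)] is at least the sum of the
   1-norms of the generators of [Z], with equality for [H1], whose widths agree by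
   symmetry.  Replacing the generators of [Z] by the primitive vectors on their
   lines gives distinct primitive vectors up to sign.  The generators of [H1] are
   those of 1-norm at most [p], so they uniquely minimise the sum of the 1-norms
   among families of at least that many such vectors. *)

Require Import Defs.
From mathcomp Require Import all_boot all_order all_algebra.
From mathcomp Require Import boolp classical_sets cardinality fsbigop.
From mathcomp Require Import perm reals.
From mathcomp Require Import ring lra.

Set Implicit Arguments.
Unset Strict Implicit.
Unset Printing Implicit Defensive.

Import Order.TTheory GRing.Theory Num.Theory.

Local Open Scope classical_set_scope.
Local Open Scope ring_scope.

(** * Scalar products, perturbation of linear functionals, and segments *)

Section Dot.
Context {R : realType} {d : nat}.
Implicit Types (c e u v w : 'rV[R]_d).

Lemma dotDl u v w : dot (u + v) w = dot u w + dot v w.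
Proof.
by rewrite /dot -big_split; apply: eq_bigr => i _; rewrite mxE mulrDl.
Qed.

Lemma dotC u v : dot u v = dot v u.
Proof. by apply: eq_bigr => i _; rewrite mulrC. Qed.

Lemma dotDr u v w : dot u (v + w) = dot u v + dot u w.
Proof. by rewrite !(dotC u) dotDl. Qed.

Lemma dotZl k u v : dot (k *: u) v = k * dot u v.
Proof. by rewrite /dot mulr_sumr; apply: eq_bigr => i _; rewrite mxE mulrA. Qed.

Lemma dotZr k u v : dot u (k *: v) = k * dot u v.
Proof. by rewrite !(dotC u) dotZl. Qed.

Lemma dotNl u v : dot (- u) v = - dot u v.
Proof. by rewrite -scaleN1r dotZl mulN1r. Qed.

Lemma dotNr u v : dot u (- v) = - dot u v.
Proof. by rewrite !(dotC u) dotNl. Qed.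

Lemma dot0r u : dot u 0 = 0.
Proof. by rewrite /dot big1 // => i _; rewrite mxE mulr0. Qed.

Lemma dot_sumr (J : finType) u (f : J -> 'rV[R]_d) :
  dot u (\sum_j f j) = \sum_j dot u (f j).
Proof. by elim/big_rec2: _ => [|j y z _ <-]; rewrite ?dot0r ?dotDr. Qed.

Lemma dot_gt0 u : u != 0 -> 0 < dot u u.
Proof.
move=> u0; rewrite lt_neqAle eq_sym; apply/andP; split; last first.
  by apply: sumr_ge0 => i _; rewrite -expr2 sqr_ge0.
apply: contra u0; rewrite /dot psumr_eq0 => [/allP h|i _]; last first.
  by rewrite -expr2 sqr_ge0.
apply/eqP/rowP => i; rewrite mxE.
by have := h i (mem_index_enum _); rewrite /= mulf_eq0 orbb => /eqP.
Qed.

(** Only finitely many [w] are involved, so a small enough [k] makes every [k * dot e w] smaller in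
    absolute value than a nonzero [dot c w]. *)
Lemma dot_perturb (ws : seq 'rV[R]_d) c e :
  exists2 k0 : R, 0 < k0 & forall k, 0 < k <= k0 ->
    forall w, w \in ws -> dot c w != 0 ->
      Num.sg (dot (c + k *: e) w) = Num.sg (dot c w).
Proof.
elim: ws => [|w ws [k0 k00 IH]]; first by exists 1.
have [k1 k10 h1] : exists2 k1 : R, 0 < k1 & forall k, 0 < k <= k1 ->
   dot c w != 0 -> Num.sg (dot (c + k *: e) w) = Num.sg (dot c w).
  (* The [+ 1] keeps the denominator positive; the indicator keeps the bound positive when
     [dot c w = 0], a case with nothing to prove. *)
  exists (`|dot c w| / (`|dot e w| + 1) + (dot c w == 0)%:R).
    have [->|cw] := eqVneq (dot c w) 0; first by rewrite normr0 mul0r add0r.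
    by rewrite addr0 divr_gt0 ?normr_gt0 // ltr_wpDl.
  move=> k /andP[kp kle] cw; move: kle; rewrite (negbTE cw) addr0.
  rewrite ler_pdivlMr ?ltr_wpDl // => kle.
  have hk : `|k * dot e w| < `|dot c w|.
    rewrite normrM gtr0_norm //; apply: lt_le_trans kle.
    by rewrite ltr_pM2l // ltrDl.
  rewrite dotDl dotZl.
  move: hk; rewrite ltr_norml => /andP[].
  case: (ltrgt0P (dot c w)) cw => // cw _ hl hu.
    by rewrite !gtr0_sg //; lra.
  by rewrite !ltr0_sg //; lra.
exists (Num.min k0 k1); first by rewrite lt_min k00.
move=> k /andP[kp]; rewrite le_min => /andP[kl0 kl1] w'.
rewrite inE => /orP[/eqP ->|h]; first by apply: h1; rewrite kp.
by apply: IH => //; rewrite kp.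
Qed.

(** By induction: adding a small multiple of [w] makes the product with [w] nonzero, since
    [dot w w > 0], and leaves the earlier signs alone. *)
Lemma generic_exists (ws : seq 'rV[R]_d) :
  exists e, forall w, w \in ws -> w != 0 -> dot e w != 0.
Proof.
elim: ws => [|w ws [e IH]]; first by exists 0.
have [k0 k00 h] := dot_perturb (w :: ws) e w.
have hk : 0 < k0 <= k0 by rewrite k00 lexx.
exists (e + k0 *: w) => w'; rewrite inE => /orP[/eqP -> w0|h' w0].
  have [ew|ew] := eqVneq (dot e w) 0.
    by rewrite dotDl dotZl ew add0r mulf_neq0 ?lt0r_neq0 ?dot_gt0.
  by rewrite -sgr_eq0 (h _ hk _ _ ew) ?sgr_eq0 // mem_head.
have ew := IH _ h' w0.
by rewrite -sgr_eq0 (h _ hk _ _ ew) ?sgr_eq0 // inE h' orbT.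
Qed.

(** A small move of [c] in a generic direction leaves the hyperplanes that contain [c] and crosses
    no other. *)
Lemma generic_near (ws : seq 'rV[R]_d) c :
  exists c', forall w, w \in ws -> w != 0 ->
    dot c' w != 0 /\ (dot c w != 0 -> Num.sg (dot c' w) = Num.sg (dot c w)).
Proof.
have [e he] := generic_exists ws.
have [k0 k00 h] := dot_perturb ws c e.
have hk : 0 < k0 <= k0 by rewrite k00 lexx.
exists (c + k0 *: e) => w hw w0; split; last exact: h.
have [cw|cw] := eqVneq (dot c w) 0.
  by rewrite dotDl dotZl cw add0r mulf_neq0 ?(lt0r_neq0 k00) // he.
by rewrite -sgr_eq0 (h _ hk _ hw cw) sgr_eq0.
Qed.

Lemma segment_point (u v : 'rV[R]_d) (t : R) :
  (1 - t) *: u + t *: v = u + t *: (v - u).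
Proof. by rewrite scalerBl scale1r scalerBr -addrA [- _ + _]addrC. Qed.

Lemma has_dim_segment (u v : 'rV[R]_d) : u != v -> has_dim (segment u v) 1.
Proof.
move=> uv; exists u, <[v - u]>%VS; split.
  by rewrite dim_vline subr_eq0 eq_sym uv.
apply/seteqP; split => y /=.
  move=> [n [w [x [hx w1 ->]]]].
  have /choice [t ht] : forall i, exists t : R, x i = u + t *: (v - u).
    by move=> i; have [t _ <-] := hx i; exists t; rewrite segment_point.
  exists ((\sum_i w i * t i) *: (v - u)).
    by rewrite memvZ // memv_line.
  under [RHS]eq_bigr do rewrite ht scalerDr scalerA.
  by rewrite big_split /= -!scaler_suml w1 scale1r.
move=> [z /vlineP [k ->] <-].
exists 2%N, (fun i : 'I_2 => if i == ord0 then 1 - k else k),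
  (fun i : 'I_2 => if i == ord0 then u else v).
split.
- move=> i; case: eqP => _.
    by exists 0; rewrite /= ?lexx ?ler01 // subr0 scale1r scale0r addr0.
  by exists 1; rewrite /= ?lexx ?ler01 // subrr scale1r scale0r add0r.
- by rewrite !big_ord_recl big_ord0 /= addr0 subrK.
- by rewrite !big_ord_recl big_ord0 /= addr0 segment_point.
Qed.

End Dot.

(** * Hamming distance between subsets of a finite type *)

Section Hamming.
Context {I : finType}.
Implicit Types A B C : {set I}.

Definition hamming A B : nat := #|[set i | (i \in A) (+) (i \in B)]%SET|.

Lemma hamming_triangle A B C :
  (hamming A C <= hamming A B + hamming B C)%N.
Proof.
rewrite /hamming; set Y := [set i | (i \in A) (+) (i \in B)]%SET; set U := [set i | (i \in B) (+) _]%SET.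
apply: (@leq_trans #|Y :|: U|); last by rewrite leq_card_setU.
apply: subset_leq_card.
apply/fintype.subsetP => i; rewrite !inE.
by case: (i \in A) (i \in B) (i \in C) => [] [] [].
Qed.

Lemma hammingxx A : hamming A A = 0%N.
Proof. by apply: eq_card0 => i; rewrite !inE addbb. Qed.

Lemma hamming_eq0 A B : hamming A B = 0%N -> A = B.
Proof.
move/card0_eq => h; apply/setP => i.
by have := h i; rewrite !inE; case: (i \in A) (i \in B) => [] [].
Qed.

End Hamming.

(** * Zonotopes: faces, vertices, edges and diameter *)

Section Zonotope.
Context {R : realType} {d : nat} {I : finType}.
Variables (a : 'rV[R]_d) (g : I -> 'rV[R]_d).
Implicit Types (c x y u v : 'rV[R]_d) (t : I -> R) (A B : {set I}) (i j : I).

Definition comb t : 'rV[R]_d := a + \sum_i t i *: g i.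

(** Parametrised form of a Minkowski sum of segments: [a] gathers the starting points and [g] the
    directions, as in [minkowski_sum_segments]. *)
Definition zon : set 'rV[R]_d :=
  [set y | exists2 t : I -> R, (forall i, 0 <= t i <= 1) & y = comb t].

Definition corner A : 'rV[R]_d := comb (fun i => (i \in A)%:R).

(** For generic [c] this set encodes the vertex that maximises [c], which turns walks between
    vertices into walks between subsets of [I]. *)
Definition pos c : {set I} := [set i | 0 < dot c (g i)]%SET.

Definition generic c : Prop := forall i, dot c (g i) != 0.

Lemma eq_comb t1 t2 : t1 =1 t2 -> comb t1 = comb t2.
Proof. by move=> h; congr (_ + _); apply: eq_bigr => i _; rewrite h. Qed.

Lemma zon_corner A : zon (corner A).
Proof. by exists (fun i => (i \in A)%:R) => // i; case: (i \in A); rewrite ?lexx ?ler01. Qed.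

Lemma corner_setU1 A i : i \notin A -> corner (i |: A) = corner A + g i.
Proof.
move=> iA; rewrite /corner /comb -addrA; congr (_ + _).
rewrite (bigD1 i) //= [in RHS](bigD1 i) //= !inE eqxx (negbTE iA) /=.
rewrite scale1r scale0r add0r addrC; congr (_ + _).
by apply: eq_bigr => j ji; rewrite !inE (negbTE ji).
Qed.

Lemma comb_convex t1 t2 (s : R) :
  (1 - s) *: comb t1 + s *: comb t2 =
  comb (fun i => (1 - s) * t1 i + s * t2 i).
Proof.
rewrite /comb !scalerDr addrACA -scalerDl subrK scale1r; congr (_ + _).
rewrite !scaler_sumr -big_split; apply: eq_bigr => i _ /=.
by rewrite !scalerA -scalerDl.
Qed.

(** Splits the gap to the maximum of [c] by generators. Each term is nonnegative, which gives both
    the maximum and its equality case. *)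
Lemma dot_corner_pos_gap c t :
  dot c (corner (pos c)) - dot c (comb t) =
  \sum_i ((i \in pos c)%:R - t i) * dot c (g i).
Proof.
rewrite !dotDr !dot_sumr opprD addrACA subrr add0r -sumrB.
by apply: eq_bigr => i _; rewrite !dotZr mulrBl.
Qed.

Lemma gap_ge0 c t i : 0 <= t i <= 1 ->
  0 <= ((i \in pos c)%:R - t i) * dot c (g i).
Proof.
move=> /andP[t0 t1]; rewrite inE; case: ltP => h.
  by rewrite mulr_ge0 ?subr_ge0 // ltW.
by rewrite sub0r mulr_le0 // oppr_le0.
Qed.

Lemma zon_dot_le c y : zon y -> dot c y <= dot c (corner (pos c)).
Proof.
move=> [t ht ->]; rewrite -subr_ge0 dot_corner_pos_gap.
by apply: sumr_ge0 => i _; exact: gap_ge0.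
Qed.

(** A zero sum of nonnegative gaps vanishes termwise, so on the face maximising [c] only the
    coefficients of generators orthogonal to [c] are free. *)
Lemma zon_dot_eq c t : (forall i, 0 <= t i <= 1) ->
  dot c (comb t) = dot c (corner (pos c)) ->
  forall i, dot c (g i) != 0 -> t i = (i \in pos c)%:R.
Proof.
move=> ht /eqP; rewrite eq_sym -subr_eq0 dot_corner_pos_gap psumr_eq0; last first.
  by move=> i _; exact: gap_ge0.
move=> /allP h i ci; have := h i (mem_index_enum _).
by rewrite /= mulf_eq0 (negbTE ci) orbF subr_eq0 => /eqP.
Qed.

Lemma comb_dot_max c t :
  (forall i, dot c (g i) != 0 -> t i = (i \in pos c)%:R) ->
  dot c (comb t) = dot c (corner (pos c)).
Proof.
move=> h; apply/esym/eqP; rewrite -subr_eq0 dot_corner_pos_gap big1 // => i _.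
have [->|ci] := eqVneq (dot c (g i)) 0; first by rewrite mulr0.
by rewrite h // subrr mul0r.
Qed.

Lemma generic_comb_inj c t : generic c -> (forall i, 0 <= t i <= 1) ->
  comb t = corner (pos c) -> forall i, t i = (i \in pos c)%:R.
Proof. by move=> gc ht e i; apply: (@zon_dot_eq c) => //; rewrite e. Qed.

Lemma indic01 A i : 0 <= ((i \in A)%:R : R) <= 1.
Proof. by case: (i \in A); rewrite ?lexx ?ler01. Qed.

Lemma generic_corner_inj c A : generic c -> corner A = corner (pos c) ->
  A = pos c.
Proof.
move=> gc e; apply/setP => i.
have /eqP := generic_comb_inj gc (indic01 A) e i.
by rewrite eqr_nat; case: (i \in A) (i \in pos c) => [] [].
Qed.

Lemma vertex_generic c : generic c -> vertex zon (corner (pos c)).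
Proof.
move=> gc; exists c, (dot c (corner (pos c))); split; first exact: zon_dot_le.
apply/seteqP; split => y /=; first by move=> ->; split => //; exact: zon_corner.
by move=> [[t ht ->] e]; apply: eq_comb => i; apply: zon_dot_eq e _ _.
Qed.

Hypothesis g_neq0 : forall i, g i != 0.
Hypothesis g_noncol : forall i j (k l : R), i != j ->
  k *: g i + l *: g j = 0 -> k = 0 /\ l = 0.

(** If a functional exposing a vertex were orthogonal to some [g i], adding [g i] to the maximal
    corner would stay in the one-point face, contradicting [g i != 0]. *)
Lemma vertexP v : vertex zon v ->
  exists2 c, generic c & v = corner (pos c).
Proof.
move=> [c [b [hb hF]]].
have [vZ vb] : (zon `&` [set x | dot c x = b]) v by rewrite -hF.
have bE : dot c (corner (pos c)) = b.
  by apply/eqP; rewrite eq_le (hb _ (zon_corner _)) -vb zon_dot_le.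
have vE A : dot c (corner A) = b -> corner A = v.
  move=> Ab; suff : [set v] (corner A) by [].
  by rewrite hF; split => //; exact: zon_corner.
exists c; last by rewrite (vE _ bE).
move=> i; apply/eqP => ci; have /eqP := g_neq0 i; apply.
have iP : i \notin pos c by rewrite inE ci ltxx.
have := vE (i |: pos c); rewrite corner_setU1 // dotDr ci addr0 => /(_ bE).
by rewrite -(vE _ bE) => /eqP; rewrite addrC -subr_eq0 addrK => /eqP.
Qed.

(** Let [c] expose the edge. [A] and [B] can differ only on generators orthogonal to [c]; each of
    these is parallel to the edge, and non-collinearity leaves at most one. *)
Lemma adjacent_hamming A B : adjacent zon (corner A) (corner B) ->
  (hamming A B <= 1)%N.
Proof.
move=> [_ _ [[c [b [hb hF]]] _]].
have inF x : segment (corner A) (corner B) x -> zon x /\ dot c x = b.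
  by rewrite hF.
have [|_ Ab] := inF (corner A).
  by exists 0; rewrite /= ?lexx ?ler01 // subr0 scale1r scale0r addr0.
have [|_ Bb] := inF (corner B).
  by exists 1; rewrite /= ?lexx ?ler01 // subrr scale1r scale0r add0r.
have bE : dot c (corner (pos c)) = b.
  by apply/eqP; rewrite eq_le (hb _ (zon_corner _)) -Ab (zon_dot_le _ (zon_corner _)).
have diff i : (i \in A) (+) (i \in B) -> dot c (g i) = 0.
  move=> iAB; apply/eqP/negPn/negP => ci; move: iAB.
  have /eqP := @zon_dot_eq c _ (indic01 A) (etrans Ab (esym bE)) i ci.
  have /eqP := @zon_dot_eq c _ (indic01 B) (etrans Bb (esym bE)) i ci.
  by rewrite !eqr_nat; case: (i \in A) (i \in B) (i \in pos c) => [] [] [].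
set w := corner B - corner A.
(* Adding [g i] to [corner (pos c)] keeps the value of [c] maximal, so both points lie on the edge
   and their difference [g i] is a multiple of [w]. *)
have seg i : dot c (g i) = 0 -> exists k : R, corner (pos c) + g i = corner A + k *: w.
  move=> ci; have iP : i \notin pos c by rewrite inE ci ltxx.
  have : segment (corner A) (corner B) (corner (i |: pos c)).
    rewrite hF; split; first exact: zon_corner.
    by rewrite /= corner_setU1 // dotDr ci addr0.
  by move=> [k _ e]; exists k; rewrite -corner_setU1 // -e segment_point.
have [k0 e0] : exists k : R, corner (pos c) = corner A + k *: w.
  have : segment (corner A) (corner B) (corner (pos c)).
    by rewrite hF; split => //; exact: zon_corner.
  by move=> [k _ <-]; exists k; rewrite segment_point.
have dir i : dot c (g i) = 0 -> exists k : R, g i = k *: w.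
  move=> /seg[k]; rewrite e0 -addrA => /addrI e; exists (k - k0).
  by rewrite scalerBl -e addrAC subrr add0r.
apply/card_le1_eqP => i j; rewrite !inE => /diff ci /diff cj.
apply/eqP/negPn/negP => ij.
have [[k ki] [l lj]] := (dir _ ci, dir _ cj).
have [|k0' _] := @g_noncol j i k (- l) ij.
  by rewrite ki lj !scalerA -scalerDl mulNr mulrC subrr scale0r.
by have := g_neq0 i; rewrite ki k0' scale0r eqxx.
Qed.

Lemma walk_hamming A B m :
  (exists2 c, generic c & A = pos c) -> (exists2 c, generic c & B = pos c) ->
  walk zon (corner A) (corner B) m -> (hamming A B <= m)%N.
Proof.
move=> hA [cB gB eB] [s [+ + <-]]; elim: s A hA => [|x s IH] A hA /=.
  by move=> _ e; rewrite (_ : A = B) ?hammingxx // eB; apply: generic_corner_inj; rewrite // e eB.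
move=> /andP[/asboolP adj ps] ls.
have [c gc xE] : exists2 c, generic c & x = corner (pos c).
  by apply: vertexP; case: adj.
apply: leq_trans (hamming_triangle A (pos c) B) _.
rewrite -add1n leq_add //; first by apply: adjacent_hamming; rewrite -xE.
by apply: IH; rewrite -?xE //; exists c.
Qed.

(** The functional [c] is orthogonal to [g i] alone, so its face has a single free coefficient and
    is a translate of the segment from [0] to [g i]. *)
Lemma adjacent_flip c c0 c1 i : generic c0 -> generic c1 -> dot c (g i) = 0 ->
  (forall j, j != i -> [/\ dot c (g j) != 0, (j \in pos c0) = (j \in pos c) &
     (j \in pos c1) = (j \in pos c)]) ->
  (i \in pos c1) = ~~ (i \in pos c0) ->
  adjacent zon (corner (pos c0)) (corner (pos c1)).
Proof.
move=> gc0 gc1 ci hj hi.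
have max0 : dot c (corner (pos c0)) = dot c (corner (pos c)).
  apply: comb_dot_max => j cj; have [|_ ->//] := hj j.
  by apply: contraNneq cj => ->; rewrite ci.
have max1 : dot c (corner (pos c1)) = dot c (corner (pos c)).
  apply: comb_dot_max => j cj; have [|_ _ ->//] := hj j.
  by apply: contraNneq cj => ->; rewrite ci.
split; [exact: vertex_generic|exact: vertex_generic|split].
  exists c, (dot c (corner (pos c))); split; first exact: zon_dot_le.
  apply/seteqP; split => y /=.
    move=> [s /andP[s0 s1] <-]; split; last first.
      by rewrite dotDr !dotZr max0 max1 -mulrDl subrK mul1r.
    rewrite comb_convex; eexists; last by [].
    move=> j /=; case: (j \in pos c0) (j \in pos c1) => [] [] /=; rewrite ?mulr1 ?mulr0; lra.
  move=> [[t ht ->] e].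
  (* The segment runs from [pos c0] to [pos c1], so the coefficient of [g i] increases along it
     exactly when [i] belongs to the latter. *)
  exists (if i \in pos c1 then t i else 1 - t i).
    by have /andP[t0 t1] := ht i; rewrite /=; case: ifP => _; lra.
  rewrite comb_convex; apply: eq_comb => j.
  have [->|ji] := eqVneq j i; first by rewrite hi; case: (i \in pos c0) => /=; ring.
  have [cj -> ->] := hj j ji.
  by rewrite (zon_dot_eq ht e cj) -mulrDl subrK mul1r.
apply: has_dim_segment; apply/eqP => e.
by have := generic_corner_inj gc1 e => /setP/(_ i); rewrite hi; case: (i \in pos c0).
Qed.

(** Moving the functional from [c0] towards [c1], the first hyperplane crossed gives an edge to a
    vertex whose Hamming distance to the target is one less. *)
Lemma walk_exists m c0 c1 : generic c0 -> generic c1 ->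
  hamming (pos c0) (pos c1) = m ->
  walk zon (corner (pos c0)) (corner (pos c1)) m.
Proof.
elim: m c0 c1 => [|m IH] c0 c1 gc0 gc1.
  by move/hamming_eq0 => ->; exists [::].
move=> hm.
(* Perturbing [c1] makes the segment from [c0] to [c1] cross the hyperplanes
   orthogonal to the generators one at a time. *)
pose W i j := dot c0 (g i) *: g j - dot c0 (g j) *: g i.
have [c hc] := generic_near (codom g ++ [seq W i j | i <- enum I, j <- enum I]) c1.
have hcg i : dot c (g i) != 0 /\ Num.sg (dot c (g i)) = Num.sg (dot c1 (g i)).
  have [||h1 h2] := hc (g i) => //; first by rewrite mem_cat codom_f.
  by split=> //; exact: h2.
(* The values of [c] on [g i] and [g j] are not proportional to those of [c0], so the two
   hyperplanes are not crossed simultaneously. *)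
have hcW i j : i != j -> dot c (W i j) != 0.
  move=> ij; have [|//|//] := hc (W i j).
    by rewrite mem_cat; apply/orP; right; apply: allpairs_f; rewrite mem_enum.
  apply/eqP; rewrite /W -scaleNr addrC => /(@g_noncol _ _ _ _ ij) [_ /eqP].
  by rewrite (negbTE (gc0 i)).
have gc : generic c by move=> i; case: (hcg i).
have pc : pos c = pos c1.
  by apply/setP => i; rewrite !inE -sgr_cp0; case: (hcg i) => _ ->; rewrite sgr_cp0.
(* The vertex depends only on [pos c1], so [c] replaces [c1] from here on. *)
rewrite -pc in hm *; clear c1 gc1 hc hcg pc.
pose D := [set i | (i \in pos c0) (+) (i \in pos c)]%SET.
have [i0 i0D] : exists i, i \in D by apply/set0Pn; rewrite -card_gt0 -/(hamming _ _) hm.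
have al i := gc0 i; have be i := gc i.
(* For [i] in [D], the time at which the segment from [c0] to [c] crosses the hyperplane orthogonal
   to [g i]. The functional [e] below is the first crossing point. *)
pose s i := dot c0 (g i) / (dot c0 (g i) - dot c (g i)).
have DP i : i \in D -> (dot c0 (g i) < 0 /\ 0 < dot c (g i)) \/ (0 < dot c0 (g i) /\ dot c (g i) < 0).
  rewrite !inE; move: (al i) (be i).
  by case: (ltrgt0P (dot c0 (g i))); case: (ltrgt0P (dot c (g i))) => //; auto.
have DPn i : i \notin D -> (dot c0 (g i) < 0 /\ dot c (g i) < 0) \/ (0 < dot c0 (g i) /\ 0 < dot c (g i)).
  rewrite !inE; move: (al i) (be i).
  by case: (ltrgt0P (dot c0 (g i))); case: (ltrgt0P (dot c (g i))) => //; auto.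
have sE i : i \in D -> [/\ dot c0 (g i) = s i * (dot c0 (g i) - dot c (g i)), 0 < s i & s i < 1].
  move=> /DP h; have n0 : dot c0 (g i) - dot c (g i) != 0.
    by case: h => -[h1 h2]; [rewrite lt_eqF|rewrite gt_eqF] => //; lra.
  have e : dot c0 (g i) = s i * (dot c0 (g i) - dot c (g i)) by rewrite /s divfK.
  split=> //; move: e; case: h => -[]; nra.
case: (@arg_minP _ _ _ i0 (mem D) s i0D) => i iDm imin.
have iD : i \in D by exact: iDm.
have [si s0 s1] := sE i iD.
pose e := c0 + s i *: (c - c0).
have dote j : dot e (g j) = dot c0 (g j) + s i * (dot c (g j) - dot c0 (g j)).
  by rewrite dotDl dotZl dotDl dotNl.
have ei : dot e (g i) = 0 by rewrite dote {1}si; ring.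
have ej j : j != i -> Num.sg (dot e (g j)) = Num.sg (dot c0 (g j)).
  move=> ji; rewrite dote; have [jD|/DPn] := boolP (j \in D); last first.
    by case=> -[h1 h2]; [rewrite !ltr0_sg|rewrite !gtr0_sg] => //; nra.
  have [sj _ _] := sE j jD.
  (* Equal crossing times would make [dot c (W j i)] vanish. *)
  have {imin} lt : s i < s j.
    rewrite lt_neqAle imin // andbT; apply/eqP => sij.
    have /eqP := hcW _ _ ji; apply; rewrite /W dotDr dotNr !dotZr.
    rewrite -sij in sj; apply: (mulfI (lt0r_neq0 s0)); rewrite mulr0.
    have bi : s i * dot c (g i) = (s i - 1) * dot c0 (g i) by lra.
    have bj : s i * dot c (g j) = (s i - 1) * dot c0 (g j) by lra.
    by rewrite mulrBr mulrCA bi [X in _ - X]mulrCA bj; ring.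
  by case: (DP j jD) => -[h1 h2]; [rewrite !ltr0_sg|rewrite !gtr0_sg] => //; nra.
have [k k0 hk] := dot_perturb (codom g) e c.
(* Just past the crossing: since [e] vanishes on [g i], the sign there is that of [c], while all
   other signs remain those of [c0]. *)
pose c' := e + k *: c.
have c'j j : j != i -> Num.sg (dot c' (g j)) = Num.sg (dot c0 (g j)).
  move=> ji; rewrite (hk k) ?k0 ?lexx ?codom_f ?ej //.
  by rewrite -sgr_eq0 ej // sgr_eq0.
have c'i : Num.sg (dot c' (g i)) = Num.sg (dot c (g i)).
  by rewrite dotDl dotZl ei add0r sgrM gtr0_sg // mul1r.
have gc' : generic c'.
  move=> j; rewrite -sgr_eq0; have [->|ji] := eqVneq j i.
    by rewrite c'i sgr_eq0.
  by rewrite c'j // sgr_eq0.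
have p'j j : j != i -> (j \in pos c') = (j \in pos c0).
  by move=> ji; rewrite !inE -sgr_cp0 c'j // sgr_cp0.
have p'i : (i \in pos c') = (i \in pos c) by rewrite !inE -sgr_cp0 c'i sgr_cp0.
have adj : adjacent zon (corner (pos c0)) (corner (pos c')).
  apply: (@adjacent_flip e _ _ i) => // [j ji|].
    have pe : (j \in pos e) = (j \in pos c0) by rewrite !inE -sgr_cp0 ej // sgr_cp0.
    by rewrite -sgr_eq0 ej // sgr_eq0 pe p'j.
  have : (i \in pos c0) (+) (i \in pos c) by move: iD; rewrite finset.in_set.
  by rewrite p'i; case: (i \in pos c0) (i \in pos c) => [] [].
have [q [pq lq sq]] : walk zon (corner (pos c')) (corner (pos c)) m.
  apply: IH => //; apply/eqP; rewrite -eqSS -hm; apply/eqP.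
  rewrite /hamming -/D (cardsD1 i D) iD add1n; congr (_.+1); apply: eq_card => j.
  rewrite finset.in_set finset.in_setD1 /D finset.in_set.
  by have [->|ji] := eqVneq j i; rewrite ?p'i ?addbb ?p'j.
exists (corner (pos c') :: q); rewrite /= lq sq pq andbT; split=> //.
exact/asboolP.
Qed.

Lemma generic_codom : exists c, generic c.
Proof. by have [c h] := generic_exists (codom g); exists c => i; rewrite h ?codom_f. Qed.

(** Graph distance is Hamming distance, which is at most [#|I|]; the vertices exposed by a generic
    [c] and by [- c] have complementary sets and attain this bound. *)
Lemma zon_diameter : diameter zon = #|I|.
Proof.
have dist c0 c1 : generic c0 -> generic c1 ->
    graph_dist zon (corner (pos c0)) (corner (pos c1)) (hamming (pos c0) (pos c1)).
  move=> gc0 gc1; split; first exact: walk_exists.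
  by move=> m; apply: walk_hamming; [exists c0|exists c1].
have dist_inj u v m n : graph_dist zon u v m -> graph_dist zon u v n -> m = n.
  by move=> [w1 h1] [w2 h2]; apply/eqP; rewrite eqn_leq h1 // h2.
have diamI : is_diameter zon #|I|.
  split=> [u v /vertexP[c0 gc0 ->] /vertexP[c1 gc1 ->]|].
    by exists (hamming (pos c0) (pos c1)); [exact: dist|exact: max_card].
  have [c gc] := generic_codom.
  have gNc : generic (- c) by move=> i; rewrite dotNl oppr_eq0.
  exists (corner (pos c)), (corner (pos (- c))).
  split; [exact: vertex_generic|exact: vertex_generic|].
  suff <- : hamming (pos c) (pos (- c)) = #|I| by exact: dist.
  rewrite /hamming -cardsT; apply: eq_card => i; rewrite !inE dotNl oppr_gt0.
  by have := gc i; case: ltrgt0P.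
apply: xget_unique => // n [h1 [u [v [vu vv dn]]]].
have [h1' [u' [v' [vu' vv' dn']]]] := diamI.
apply/eqP; rewrite eqn_leq; apply/andP; split.
  by have [m dm] := h1' u v vu vv; rewrite (dist_inj _ _ _ _ dm dn).
by have [m dm] := h1 u' v' vu' vv'; rewrite (dist_inj _ _ _ _ dm dn').
Qed.

(* A functional vanishing on [g i] only exposes an edge parallel to [g i], so
   [g i] is a difference of two vertices. *)
Lemma zon_generator_vertices i : exists A,
  [/\ i \notin A, vertex zon (corner A) & vertex zon (corner (i |: A))].
Proof.
(* The component of [g j] orthogonal to [g i], nonzero for [j != i] by non-collinearity. Likewise
   [c] is the orthogonal projection of [e], so [dot c (g j) = dot e (W j)]. *)
pose W j := g j - (dot (g j) (g i) / dot (g i) (g i)) *: g i.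
have gi0 := lt0r_neq0 (dot_gt0 (g_neq0 i)).
have [e he] := generic_exists (codom W).
pose c := e - (dot e (g i) / dot (g i) (g i)) *: g i.
have ci : dot c (g i) = 0 by rewrite dotDl dotNl dotZl divfK // subrr.
have cj j : j != i -> dot c (g j) != 0.
  move=> ji; suff -> : dot c (g j) = dot e (W j).
    apply: he; first exact: codom_f.
    apply/eqP; rewrite /W -{1}[g j]scale1r -scaleNr => /(@g_noncol _ _ _ _ ji) [/eqP].
    by rewrite oner_eq0.
  by rewrite dotDl dotNl dotZl dotDr dotNr dotZr (dotC (g i) (g j)); field.
have iP : i \notin pos c by rewrite inE ci ltxx.
(* Tilting [c] slightly towards [g i] or [- g i] decides the sign on [g i] and keeps all the others:
   the two ends of the edge. *)
have [k k0 hk] := dot_perturb (codom g) c (g i).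
have [l l0 hl] := dot_perturb (codom g) c (- g i).
have kj j : j != i -> Num.sg (dot (c + k *: g i) (g j)) = Num.sg (dot c (g j)).
  by move=> ji; rewrite (hk k) ?k0 ?lexx ?codom_f ?cj.
have lj j : j != i -> Num.sg (dot (c + l *: - g i) (g j)) = Num.sg (dot c (g j)).
  by move=> ji; rewrite (hl l) ?l0 ?lexx ?codom_f ?cj.
have ki : 0 < dot (c + k *: g i) (g i).
  by rewrite dotDl ci add0r dotZl mulr_gt0 // dot_gt0.
have li : dot (c + l *: - g i) (g i) < 0.
  by rewrite dotDl ci add0r dotZl dotNl mulrN oppr_lt0 mulr_gt0 // dot_gt0.
exists (pos c); split => //.
  have <- : pos (c + l *: - g i) = pos c.
    apply/setP => j; rewrite !inE; have [->|ji] := eqVneq j i.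
      by rewrite ci ltxx ltNge ltW.
    by rewrite -sgr_cp0 lj // sgr_cp0.
  apply: vertex_generic => j; have [->|ji] := eqVneq j i; first by rewrite lt_eqF.
  by rewrite -sgr_eq0 lj // sgr_eq0 cj.
have <- : pos (c + k *: g i) = i |: pos c.
  apply/setP => j; rewrite !inE; have [->|ji] := eqVneq j i => //.
  by rewrite -sgr_cp0 kj // sgr_cp0.
apply: vertex_generic => j; have [->|ji] := eqVneq j i; first by rewrite gt_eqF.
by rewrite -sgr_eq0 kj // sgr_eq0 cj.
Qed.

End Zonotope.

(** * Primitive integer vectors and the coordinate symmetry of the generators of [H1] *)

Section LatticeVectors.
Context {d : nat}.
Implicit Types x y z : 'rV[int]_d.

Lemma primitiveN x : primitive x -> primitive (- x).
Proof.
move=> [x0 xg]; split; first by rewrite oppr_eq0.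
by rewrite -[RHS]xg; apply: eq_bigr => i _; rewrite mxE abszN.
Qed.

Lemma norm1N x : norm1 (- x) = norm1 x.
Proof. by apply: eq_bigr => i _; rewrite mxE normrN. Qed.

Lemma norm1Z (m : int) x : norm1 (m *: x) = `|m| * norm1 x.
Proof. by rewrite /norm1 mulr_sumr; apply: eq_bigr => i _; rewrite mxE normrM. Qed.

Lemma norm1_gt0 x : x != 0 -> 0 < norm1 x.
Proof.
move=> x0; rewrite lt_neqAle eq_sym sumr_ge0 // andbT.
apply: contra x0; rewrite /norm1 psumr_eq0 // => /allP h.
apply/eqP/rowP => i; rewrite mxE.
by have := h i (mem_index_enum _); rewrite /= normr_eq0 => /eqP.
Qed.

Lemma first_nonzero_posN x : first_nonzero_pos x -> ~ first_nonzero_pos (- x).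
Proof.
move=> [i [xi hi]] [j [xj hj]]; move: xj; rewrite mxE oppr_gt0 => xj.
have [ij|ji|/ord_inj ij] := ltngtP i j.
- by have := hj i ij; rewrite mxE => /eqP; rewrite oppr_eq0 => /eqP e; rewrite e ltxx in xi.
- by rewrite hi // ltxx in xj.
- by rewrite ij in xi; have := lt_trans xi xj; rewrite ltxx.
Qed.

Lemma first_nonzero_pos_sign x : x != 0 ->
  first_nonzero_pos x \/ first_nonzero_pos (- x).
Proof.
move=> x0; have [i0 xi0] : exists i, x ord0 i != 0.
  apply/existsP; apply: contraNT x0; rewrite negb_exists => /forallP h.
  by apply/eqP/rowP => i; rewrite mxE; apply/eqP/negPn.
case: (@arg_minnP _ i0 (fun i => x ord0 i != 0) (fun i => i : nat) xi0) => i xi imin.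
have hj (j : 'I_d) : (j < i)%N -> x ord0 j = 0.
  by move=> ji; apply/eqP/negPn/negP => /imin; rewrite leqNgt ji.
case: (ltrgt0P (x ord0 i)) xi => // xi _; [left|right]; exists i.
  by split.
by rewrite mxE oppr_gt0; split=> // j /hj e; rewrite mxE e oppr0.
Qed.

(** Multiplying a coordinate of [x] by the gcd of [y], which is 1, and using proportionality gives
    the same coordinate of [y] in absolute value. The sign convention then settles the sign. *)
Lemma parallel_primitive_eq x y : primitive x -> primitive y ->
  first_nonzero_pos x -> first_nonzero_pos y ->
  (forall k l, x ord0 k * y ord0 l = x ord0 l * y ord0 k) -> x = y.
Proof.
move=> [_ gx] [_ gy] [i [xi hi]] [j [yj hj]] par.
have xy l : `|x ord0 l|%N = `|y ord0 l|%N.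
  have -> : `|x ord0 l|%N = (`|x ord0 l| * \big[gcdn/0]_(k < d) `|y ord0 k|)%N.
    by rewrite gy muln1.
  have -> : `|y ord0 l|%N = (\big[gcdn/0]_(k < d) `|x ord0 k| * `|y ord0 l|)%N.
    by rewrite gx mul1n.
  rewrite (big_morph (fun n => `|x ord0 l| * n)%N (id1 := 0%N) (op1 := gcdn)) ?muln0 //; last first.
    by move=> ? ?; rewrite muln_gcdr.
  rewrite (big_morph (fun n => n * `|y ord0 l|)%N (id1 := 0%N) (op1 := gcdn)) ?mul0n //; last first.
    by move=> ? ?; rewrite muln_gcdl.
  by apply: eq_bigr => k _; rewrite -!abszM par.
have z l : x ord0 l = 0 -> y ord0 l = 0.
  by move=> e; have := xy l; rewrite e => /esym/eqP; rewrite absz_eq0 => /eqP.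
have z' l : y ord0 l = 0 -> x ord0 l = 0.
  by move=> e; have := xy l; rewrite e => /eqP; rewrite absz_eq0 => /eqP.
have ij : i = j.
  have [ij|ji|/ord_inj//] := ltngtP i j.
    by rewrite (z' _ (hj _ ij)) ltxx in xi.
  by rewrite (z _ (hi _ ji)) ltxx in yj.
subst j.
have xyi : x ord0 i = y ord0 i by rewrite -(gtz0_abs xi) -(gtz0_abs yj) xy.
apply/rowP => l; have := par i l; rewrite -xyi [RHS]mulrC.
by move/(mulfI (lt0r_neq0 xi)).
Qed.

(** Divides by the gcd of the coordinates; [m] is negative when the quotient has to be negated to
    meet the sign convention. *)
Lemma primitive_decomposition z : z != 0 -> exists x (m : int),
  [/\ primitive x, first_nonzero_pos x, m != 0 & z = m *: x].
Proof.
move=> z0; pose G := (\big[gcdn/0%N]_(i < d) `|z ord0 i|)%N.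
have Gdvd l : (G %| `|z ord0 l|)%N by rewrite /G (bigD1 l) //= dvdn_gcdl.
have G0 : G != 0%N.
  apply: contra z0 => /eqP G0; apply/eqP/rowP => l; rewrite mxE.
  by have := Gdvd l; rewrite G0 dvd0n absz_eq0 => /eqP.
pose x : 'rV[int]_d := \row_l (z ord0 l %/ G%:Z)%Z.
have zE : z = G%:Z *: x.
  by apply/rowP => l; rewrite !mxE mulrC divzK // dvdzE.
have x0 : x != 0 by apply: contra z0; rewrite zE => /eqP ->; rewrite scaler0.
have px : primitive x.
  split=> //; apply/eqP; rewrite -(@eqn_pmul2l G) ?lt0n // muln1 {2}/G.
  rewrite (big_morph (fun n => G * n)%N (id1 := 0%N) (op1 := gcdn)) ?muln0 //; last first.
    by move=> ? ?; rewrite muln_gcdr.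
  by apply/eqP/eq_bigr => l _; rewrite [in RHS]zE !mxE abszM.
have [fx|fx] := first_nonzero_pos_sign x0.
  by exists x, G%:Z; split.
exists (- x), (- G%:Z); split => //; first exact: primitiveN.
  by rewrite oppr_eq0.
by rewrite scalerN scaleNr opprK.
Qed.

(** Coordinates lie between [- p] and [p], so a shift by [p] codes them in ['I_(p + p).+1]. *)
Lemma H1_generators_finite p : finite_set (@H1_generators d p).
Proof.
pose f (u : {ffun 'I_d -> 'I_(p + p).+1}) : 'rV[int]_d :=
  \row_l ((u l : nat)%:Z - p%:Z).
apply: (@sub_finite_set _ _ (f @` setT)); last first.
  by apply: finite_image; exact: finite_finset.
move=> z [_ zp _] /=.
have zl l : `|z ord0 l| <= p%:Z.
  by apply: le_trans zp; rewrite /norm1 (bigD1 l) //= lerDl sumr_ge0.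
exists [ffun l => inord (absz (z ord0 l + p%:Z))] => //.
apply/rowP => l; rewrite mxE ffunE; have := zl l; rewrite ler_norml => /andP[h1 h2].
have h0 : 0 <= z ord0 l + p%:Z by rewrite -lerBlDr sub0r.
rewrite inordK; first by rewrite gez0_abs // addrK.
by rewrite ltnS -lez_nat gez0_abs // PoszD lerD2r.
Qed.

(** Permuting coordinates preserves primitivity and the 1-norm but may break the sign convention,
    hence the two alternatives. *)
Lemma H1_generators_reindex p (s : 'I_d -> 'I_d) z : involutive s ->
  H1_generators p z ->
  exists2 y, H1_generators p y &
    y = \row_l z ord0 (s l) \/ y = - \row_l z ord0 (s l).
Proof.
move=> sK [[z0 zg] zp fz]; pose y : 'rV[int]_d := \row_l z ord0 (s l).
have y0 : y != 0.
  apply: contra z0 => /eqP/rowP h; apply/eqP/rowP => l.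
  by have := h (s l); rewrite !mxE sK.
have py : primitive y.
  split=> //; rewrite -[RHS]zg [in RHS](reindex_inj (inv_inj sK)) /=.
  by apply: eq_bigr => l _; rewrite mxE.
have ny : norm1 y <= p%:Z.
  apply: le_trans zp; rewrite /norm1 [leRHS](reindex_inj (inv_inj sK)) /=.
  by apply: ler_sum => l _; rewrite mxE.
have [fy|fy] := first_nonzero_pos_sign y0.
  by exists y; [split|left].
by exists (- y); [split=> //; [exact: primitiveN|rewrite norm1N]|right].
Qed.

(** Exchanging coordinates [l] and [l'] permutes the generators up to sign, and absolute values do
    not see the sign. *)
Lemma H1_widths_eq p (I : finType) (h : I -> 'rV[int]_d) (l l' : 'I_d) :
  injective h -> range h = H1_generators p ->
  \sum_i `|h i ord0 l| = \sum_i `|h i ord0 l'|.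
Proof.
move=> hinj hH; pose s := tperm l l'.
have hi i : H1_generators p (h i) by rewrite -hH; exists i.
have /choice [phi hphi] i : exists j,
    h j = \row_k h i ord0 (s k) \/ h j = - \row_k h i ord0 (s k).
  have [y] := H1_generators_reindex (tpermK l l') (hi i).
  by rewrite -hH => -[j _ <-] ?; exists j.
have row_inj (x y : 'rV[int]_d) : \row_k x ord0 (s k) = \row_k y ord0 (s k) -> x = y.
  by move=> /rowP e; apply/rowP => k; have := e (s k); rewrite !mxE tpermK.
have rowN (x : 'rV[int]_d) : - \row_k x ord0 (s k) = \row_k (- x) ord0 (s k).
  by apply/rowP => k; rewrite !mxE.
(* A collision with opposite signs would make a vector and its opposite both satisfy the sign
   convention. *)
have phi_inj : injective phi.
  move=> i j e; apply: hinj.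
  have [_ _ fi] := hi i; have [_ _ fj] := hi j.
  have := hphi j; rewrite -e; case: (hphi i) => ->; rewrite !rowN.
    case=> /row_inj // eij; case: (first_nonzero_posN fj); by rewrite -eij.
  case=> /row_inj => [eij|/oppr_inj //].
  by case: (first_nonzero_posN fi); rewrite eij.
rewrite (reindex_inj phi_inj) /=; apply: eq_bigr => i _.
have -> : `|h (phi i) ord0 l| = `|h i ord0 (s l)|.
  by case: (hphi i) => ->; rewrite !mxE ?normrN.
by rewrite tpermL.
Qed.

End LatticeVectors.

(** * Lattice zonotopes: box size, integrality and change of generators *)

Section LatticeZonotopes.
Context {R : realType} {d : nat}.

Local Notation lp := (@lattice_point R d).

Lemma lattice_pointD x y : lp (x + y) = lp x + lp y.
Proof. by apply/rowP => l; rewrite !mxE intrD. Qed.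

Lemma lattice_pointN x : lp (- x) = - lp x.
Proof. by apply/rowP => l; rewrite !mxE intrN. Qed.

Lemma lattice_pointZ (m : int) x : lp (m *: x) = m%:~R *: lp x.
Proof. by apply/rowP => l; rewrite !mxE intrM. Qed.

Lemma lattice_point0 : lp 0 = 0.
Proof. by apply/rowP => l; rewrite !mxE. Qed.

Lemma lattice_point_sum (I : finType) (P : pred I) (f : I -> 'rV[int]_d) :
  lp (\sum_(i | P i) f i) = \sum_(i | P i) lp (f i).
Proof.
by rewrite (big_morph _ lattice_pointD lattice_point0).
Qed.

Lemma lattice_point_eq0 x : (lp x == 0) = (x == 0).
Proof.
apply/eqP/eqP => [/rowP h|->]; last exact: lattice_point0.
by apply/rowP => l; have := h l; rewrite !mxE => /eqP; rewrite intr_eq0 => /eqP.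
Qed.

(** A nontrivial relation annihilates every 2 by 2 minor of the pair, so the two primitive vectors
    are parallel and then equal. *)
Lemma primitive_noncollinear (x y : 'rV[int]_d) (k l : R) :
  primitive x -> primitive y -> first_nonzero_pos x -> first_nonzero_pos y ->
  x != y -> k *: lp x + l *: lp y = 0 -> k = 0 /\ l = 0.
Proof.
move=> px py fx fy xy /rowP e; apply/not_notP => kl.
case/eqP: xy; apply: parallel_primitive_eq => // i j.
apply/eqP; rewrite -subr_eq0 -(intr_eq0 R) intrB !intrM.
set xi := (x ord0 i)%:~R; set xj := (x ord0 j)%:~R.
set yi := (y ord0 i)%:~R; set yj := (y ord0 j)%:~R.
have ei : k * xi + l * yi = 0 by have := e i; rewrite !mxE.
have ej : k * xj + l * yj = 0 by have := e j; rewrite !mxE.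
have hk : k * (xi * yj - xj * yi) = (k * xi + l * yi) * yj - (k * xj + l * yj) * yi by ring.
have hl : l * (xi * yj - xj * yi) = (k * xj + l * yj) * xi - (k * xi + l * yi) * xj by ring.
rewrite ei ej !mul0r subrr in hk; rewrite ei ej !mul0r subrr in hl.
apply/negPn/negP => n0; apply: kl; split; apply/eqP.
  by move/eqP: hk; rewrite mulf_eq0 (negbTE n0) orbF.
by move/eqP: hl; rewrite mulf_eq0 (negbTE n0) orbF.
Qed.

Section Box.
Context {I : finType}.
Variables (z0 : 'rV[int]_d) (z : I -> 'rV[int]_d).

(** Length of the projection of the zonotope to coordinate [l]. *)
Definition width (l : 'I_d) : int := \sum_i `|z i ord0 l|.

Local Notation Z := (zon (lp z0) (fun i => lp (z i))).

Lemma comb_coord (t : I -> R) l :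
  comb (lp z0) (fun i => lp (z i)) t ord0 l =
  (z0 ord0 l)%:~R + \sum_i t i * (z i ord0 l)%:~R.
Proof.
rewrite !mxE summxE; congr (_ + _).
by apply: eq_bigr => i _; rewrite !mxE.
Qed.

Lemma fits_in_box_zon k : fits_in_box Z k <-> forall l, width l <= k.
Proof.
split=> [[w hw] l|hk].
  (* The corners of [P] and [N] have the largest and the smallest coordinate [l]; the difference is
     [width l]. *)
  pose P := [set i | 0 < z i ord0 l]%SET; pose N := [set i | z i ord0 l < 0]%SET.
  have tr A : translate (lp w) Z (lp w + corner (lp z0) (fun i => lp (z i)) A).
    by exists (corner (lp z0) (fun i => lp (z i)) A) => //; exact: zon_corner.
  have /andP[_ hP] := hw _ (tr P) l; have /andP[hN _] := hw _ (tr N) l.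
  have : (width l)%:~R =
      (lp w + corner (lp z0) (fun i => lp (z i)) P) ord0 l -
      (lp w + corner (lp z0) (fun i => lp (z i)) N) ord0 l.
    rewrite ![(lp w + _) _ _]mxE !comb_coord opprD addrACA subrr add0r.
    rewrite opprD addrACA subrr add0r -sumrB /width (big_morph _ (@intrD R) (erefl _)).
    apply: eq_bigr => i _; rewrite -mulrBl !inE.
    case: (ltrgt0P (z i ord0 l)) => h.
    - by rewrite subr0 mul1r.
    - by rewrite sub0r mulN1r intrN.
    - by rewrite h mulr0.
  by move=> e; rewrite -(ler_int R) e; lra.
(* The minimum of coordinate [l] is that of [z0] plus all negative entries of the generators; [w]
   moves it to 0. *)
pose w : 'rV[int]_d := \row_l (- z0 ord0 l - \sum_i Num.min (z i ord0 l) 0).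
exists w => _ [_ [t ht ->] <-] l.
have -> : (lp w + comb (lp z0) (fun i => lp (z i)) t) ord0 l =
    \sum_i (t i * (z i ord0 l)%:~R - (Num.min (z i ord0 l) 0)%:~R).
  rewrite [LHS]mxE comb_coord !mxE intrB intrN (big_morph _ (@intrD R) (erefl _)).
  by rewrite sumrB; ring.
have term i : 0 <= t i * (z i ord0 l)%:~R - (Num.min (z i ord0 l) 0)%:~R
    <= (`|z i ord0 l|%:~R : R).
  have /andP[t0 t1] := ht i.
  have [h|h] := leP (z i ord0 l) 0; rewrite ?(ler0_norm h) ?(gtr0_norm h) ?intrN.
    have : ((z i ord0 l)%:~R : R) <= 0 by rewrite lerz0.
    by move: (_%:~R : R) => x x0; nra.
  have : 0 < ((z i ord0 l)%:~R : R) by rewrite ltr0z.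
  by move: (_%:~R : R) => x x0; nra.
apply/andP; split; first by apply: sumr_ge0 => i _; case/andP: (term i).
apply: (@le_trans _ _ ((width l)%:~R)); last by rewrite ler_int.
rewrite /width (big_morph _ (@intrD R) (erefl _)).
by apply: ler_sum => i _; case/andP: (term i).
Qed.

(** The argument [l] witnesses [0 < d], so that a largest width exists. *)
Lemma box_size_zon (l : 'I_d) : exists2 l0,
  box_size Z = width l0 & forall l, width l <= width l0.
Proof.
case: (@arg_maxP _ _ _ l xpredT width isT) => l0 _ hl0.
have hmax k : width k <= width l0 by exact: hl0.
exists l0 => //; apply: xget_unique.
  by split; [exact/fits_in_box_zon|move=> k /fits_in_box_zon].
move=> k [/fits_in_box_zon h1 h2]; apply/eqP; rewrite eq_le h1 h2 //.
exact/fits_in_box_zon.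
Qed.

Lemma sum_width : \sum_l width l = \sum_i norm1 (z i).
Proof. by rewrite /width exchange_big. Qed.

(** The largest of the [d] widths is at least their average. *)
Lemma sum_norm1_le_box_size (l : 'I_d) : \sum_i norm1 (z i) <= d%:Z * box_size Z.
Proof.
have [l0 -> hl0] := box_size_zon l; rewrite -sum_width.
apply: le_trans (ler_sum _ (fun k _ => hl0 k)) _.
by rewrite sumr_const card_ord -mulr_natl natz.
Qed.

End Box.

Lemma zon_translate (I : finType) a (g : I -> 'rV[R]_d) :
  zon a g = translate a (zon 0 g).
Proof.
apply/seteqP; split => y.
  by move=> [t ht ->]; exists (comb 0 g t); [exists t|rewrite /comb add0r].
by move=> [_ [t ht ->] <-]; exists t; rewrite // /comb add0r.
Qed.

(** Reversing a generator only moves the starting point of its segment: the base absorbs [g i] and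
    the coefficient [t i] becomes [1 - t i]. *)
Lemma zon_flip (I : finType) a (g g' : I -> 'rV[R]_d) :
  (forall i, g i = g' i \/ g i = - g' i) -> exists b, zon a g = zon b g'.
Proof.
move=> h; pose S i := g i != g' i.
have gE i : g i = if S i then - g' i else g' i.
  rewrite /S; case: eqP => //= n; by case: (h i).
have key t : comb (a + \sum_(i | S i) g i) g'
    (fun i => if S i then 1 - t i else t i) = comb a g t.
  rewrite /comb -addrA; congr (_ + _).
  rewrite [X in X + _]big_mkcond -big_split; apply: eq_bigr => i _ /=.
  rewrite (gE i); case: (S i); last by rewrite add0r.
  by rewrite scalerBl scale1r scalerN addrA addNr add0r.
exists (a + \sum_(i | S i) g i); apply/seteqP; split => y [t ht ->].
  exists (fun i => if S i then 1 - t i else t i); last by rewrite key.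
  by move=> i; have := ht i; case: ifP => _; lra.
exists (fun i => if S i then 1 - t i else t i).
  by move=> i; have := ht i; case: ifP => _; lra.
rewrite -key; apply: eq_comb => i; case: (S i) => //; ring.
Qed.

Lemma free2P (u v : 'rV[R]_d) : free [:: u; v] ->
  forall k l, k *: u + l *: v = 0 -> k = 0 /\ l = 0.
Proof.
move=> uv k l e; have /freeP h : free [tuple u; v] by [].
have {}h := h (fun i => if i == ord0 then k else l).
have e' : \sum_(i < 2) (if i == ord0 then k else l) *: [tuple u; v]`_i = 0.
  by rewrite !big_ord_recl big_ord0 /= addr0.
by split; [exact: (h e' ord0)|exact: (h e' (lift ord0 ord0))].
Qed.

Lemma sum_fsbigT (I : finType) (f : I -> 'rV[R]_d) :
  \sum_(i \in [set: I]) f i = \sum_i f i.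
Proof.
rewrite (fsbig_seq _ _ (index_enum_uniq I)); apply: eq_fsbigl.
by apply/seteqP; split => i //= _; exact: mem_index_enum.
Qed.

Lemma minkowski_sum_segments (I : finType) (u v : I -> 'rV[R]_d) :
  minkowski_sum [set: I] (fun i => segment (u i) (v i)) =
  zon (\sum_i u i) (fun i => v i - u i).
Proof.
apply/seteqP; split => y.
  move=> [f hf ->]; rewrite sum_fsbigT.
  have /choice [t ht] i : exists t : R, 0 <= t <= 1 /\ f i = u i + t *: (v i - u i).
    by have [t h <-] := hf i Logic.I; exists t; rewrite segment_point.
  exists t; first by move=> i; case: (ht i).
  by rewrite /comb -big_split; apply: eq_bigr => i _; case: (ht i).
move=> [t ht ->]; exists (fun i => u i + t i *: (v i - u i)).
  by move=> i _; exists (t i); [exact: ht|rewrite segment_point].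
by rewrite sum_fsbigT big_split.
Qed.

Lemma H1_zon p (I : finType) (h : I -> 'rV[int]_d) : injective h ->
  range h = H1_generators p -> H1 R d p = zon 0 (fun i => lp (h i)).
Proof.
move=> hinj hH.
transitivity (minkowski_sum [set: I] (fun i => segment (0 : 'rV[R]_d) (lp (h i)))).
  have sumE (f : 'rV[int]_d -> 'rV[R]_d) :
      \sum_(x \in H1_generators p) f x = \sum_(i \in [set: I]) f (h i).
    by rewrite -hH fsbig_image // => i j _ _; exact: hinj.
  apply/seteqP; split => y [f hf ->].
    by exists (f \o h) => [i _|]; [apply: hf; rewrite -hH; exists i|rewrite sumE].
  (* A selection over a set is a function on the whole type, so [f] is carried along [h] and is
     unconstrained outside the range. *)
  have /choice [k hk] (x : 'rV[int]_d) : exists v, (exists2 i, x = h i & v = f i) \/ ~ range h x.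
    have [[i _ <-]|nx] := pselect (range h x); last by exists 0; right.
    by exists (f i); left; exists i.
  have kh i : k (h i) = f i.
    by case: (hk (h i)) => [[j /hinj -> ->]//|[]]; exists i.
  exists k; last by rewrite sumE; apply: eq_fsbigr => i _; rewrite kh.
  by rewrite -hH => _ [i _ <-]; rewrite kh; exact: hf.
rewrite minkowski_sum_segments big1 //; congr (zon _ _).
by apply/funext => i; rewrite subr0.
Qed.

(** Generators are differences of lattice vertices; subtracting from any vertex the generators it
    uses then shows that the base point is integral. *)
Lemma lattice_zon_integral (I : finType) a (g : I -> 'rV[R]_d) :
  (forall i, g i != 0) ->
  (forall i j (k l : R), i != j -> k *: g i + l *: g j = 0 -> k = 0 /\ l = 0) ->
  (forall v, vertex (zon a g) v -> exists z, v = lp z) ->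
  exists z0 (z : I -> 'rV[int]_d), a = lp z0 /\ forall i, g i = lp (z i).
Proof.
move=> g0 gn lat.
have /choice [z hz] i : exists z, g i = lp z.
  have [A [iA /lat[x hx] /lat[y hy]]] := zon_generator_vertices a g0 gn i.
  exists (y - x); rewrite lattice_pointD lattice_pointN -hx -hy corner_setU1 //.
  by rewrite addrAC subrr add0r.
have [c gc] := generic_codom g0.
have [x hx] := lat _ (vertex_generic a gc).
exists (x - \sum_(i in pos g c) z i), z; split=> //.
rewrite lattice_pointD lattice_pointN lattice_point_sum -hx /corner /comb.
rewrite -[LHS]addr0 -addrA; congr (_ + _); apply/esym/eqP; rewrite subr_eq0; apply/eqP.
rewrite [RHS]big_mkcond; apply: eq_bigr => i _; rewrite hz.
by case: (i \in pos g c); rewrite ?scale1r ?scale0r.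
Qed.

End LatticeZonotopes.

(* [N - p] is nonpositive on the image of [h] and positive on the rest of the
   image of [x]. *)
Lemma sum_excess (T : eqType) (I J : finType) (N : T -> int) (p : int)
    (x : I -> T) (h : J -> T) :
  injective x -> injective h -> (forall j, N (h j) <= p) ->
  (forall i, N (x i) <= p -> x i \in codom h) ->
  \sum_j (N (h j) - p) <= \sum_i (N (x i) - p) /\
  (\sum_i (N (x i) - p) <= \sum_j (N (h j) - p) -> forall i, x i \in codom h).
Proof.
move=> xinj hinj hN xN; pose f z := N z - p.
(* The discarded terms are nonpositive. *)
have le1 : \sum_j f (h j) <= \sum_(j | h j \in codom x) f (h j).
  rewrite (bigID (fun j => h j \in codom x)) /= gerDl.
  by apply: sumr_le0 => j _; rewrite subr_le0.
(* By injectivity, both sums run once over the common part of the two images. *)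
have common : \sum_(j | h j \in codom x) f (h j) = \sum_(i | x i \in codom h) f (x i).
  transitivity (\sum_(w <- codom h | w \in codom x) f w).
    by rewrite /codom /image_mem big_map big_enum_cond.
  transitivity (\sum_(w <- codom x | w \in codom h) f w); last first.
    by rewrite /codom /image_mem big_map big_enum_cond.
  rewrite -big_filter -[RHS]big_filter; apply: perm_big; apply: uniq_perm.
  - by rewrite filter_uniq // map_inj_uniq // enum_uniq.
  - by rewrite filter_uniq // map_inj_uniq // enum_uniq.
  - by move=> w; rewrite !mem_filter andbC.
have gt0 i : x i \notin codom h -> 0 < f (x i).
  by move=> ni; rewrite subr_gt0 ltNge; apply: contra ni => /xN.
have le2 : 0 <= \sum_(i | x i \notin codom h) f (x i).
  by apply: sumr_ge0 => i /gt0/ltW.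
have split2 : \sum_i f (x i) =
    \sum_(i | x i \in codom h) f (x i) + \sum_(i | x i \notin codom h) f (x i).
  by rewrite (bigID (fun i => x i \in codom h)).
split; first by rewrite -/(f _) split2 -common; apply: le_trans le1 _; rewrite lerDl.
move=> le i; apply/negPn/negP => ni.
have : 0 < \sum_(i | x i \notin codom h) f (x i).
  rewrite (bigD1 i) //= ltr_pwDl ?gt0 //.
  by apply: sumr_ge0 => j /andP[/gt0/ltW].
rewrite ltNge => /negP; apply.
have := le_trans le le1; rewrite common => {}le.
by rewrite -(lerD2l (\sum_(i | x i \in codom h) f (x i))) addr0 -split2.
Qed.

Theorem theorem3p1 (R : realType) (d p : nat) (Z : set 'rV[R]_d)
  (hp : (0 < p)%N) (hZ : lattice_zonotope Z) (hdim : has_dim Z d) :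
  [/\ (diameter (H1 R d p) <= diameter Z)%N ->
        box_size (H1 R d p) <= box_size Z,
      (diameter (H1 R d p) < diameter Z)%N ->
        box_size (H1 R d p) < box_size Z &
      diameter (H1 R d p) = diameter Z ->
      box_size (H1 R d p) = box_size Z ->
        exists t : 'rV[R]_d, Z = translate t (H1 R d p)].
Proof.
have [[n [u [v [uv uvf ZE]]]] [_ lat]] := hZ.
rewrite minkowski_sum_segments in ZE.
have g0 i : v i - u i != 0 by rewrite subr_eq0 eq_sym uv.
have gn i j (k l : R) : i != j ->
    k *: (v i - u i) + l *: (v j - u j) = 0 -> k = 0 /\ l = 0.
  by move=> ij; apply: free2P; exact: uvf.
have dZ : diameter Z = n by rewrite ZE zon_diameter // card_ord.
rewrite ZE in lat; have [z0 [z [aE gE]]] := lattice_zon_integral g0 gn lat.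
have {}ZE : Z = zon (lattice_point z0) (fun i => lattice_point (z i)).
  by rewrite ZE aE; congr (zon _ _); apply/funext => i.
have z_neq0 i : z i != 0 by have := g0 i; rewrite gE lattice_point_eq0.
have /choice [x hx] i : exists x, primitive x /\ first_nonzero_pos x /\
    exists2 m : int, m != 0 & z i = m *: x.
  have [x [m [px fx m0 zE]]] := primitive_decomposition (z_neq0 i).
  by exists x; split=> //; split=> //; exists m.
have px i : primitive (x i) by case: (hx i).
have fx i : first_nonzero_pos (x i) by case: (hx i) => _ [].
(* If [x i = x j], then [mj *: z i - mi *: z j = 0] is a nontrivial relation between two generators
   of [Z]. *)
have xinj : injective x.
  move=> i j xij; apply/eqP/negPn/negP => ij.
  have [_ [_ [mi mi0 zi]]] := hx i; have [_ [_ [mj mj0 zj]]] := hx j.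
  have [|/eqP] := @gn i j mj%:~R (- mi%:~R) ij.
    by rewrite !gE zi zj xij !lattice_pointZ !scalerA mulNr mulrC -scalerDl subrr scale0r.
  by rewrite intr_eq0 (negbTE mj0).
have /finite_seqP [s sH] := @H1_generators_finite d p.
pose h (j : seq_sub s) : 'rV[int]_d := ssval j.
have hinj : injective h by exact: val_inj.
have hH : range h = H1_generators p.
  rewrite sH; apply/seteqP; split => [_ [j _ <-]|w ws] /=; first exact: ssvalP.
  by exists (SeqSub ws).
have HE : H1 R d p = zon 0 (fun j => lattice_point (h j)) := H1_zon hinj hH.
have hj j : H1_generators p (h j) by rewrite -hH; exists j.
have ph j : primitive (h j) by case: (hj j).
have fh j : first_nonzero_pos (h j) by case: (hj j).
set m := #|{: seq_sub s}|.
have dH : diameter (H1 R d p) = m.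
  rewrite HE zon_diameter // => [j|i j k l ij].
    by rewrite lattice_point_eq0; case: (ph j).
  by apply: primitive_noncollinear => //; apply: contra ij => /eqP/hinj ->.
have xcod i : norm1 (x i) <= p%:Z -> x i \in codom h.
  move=> xp; have : H1_generators p (x i) by split.
  by rewrite -hH => -[j _ <-]; exact: codom_f.
have hp' j : norm1 (h j) <= p%:Z by case: (hj j).
have [le_sum eq_sum] := sum_excess xinj hinj hp' xcod.
rewrite !sumrB !sumr_const card_ord -/m in le_sum eq_sum.
have nx0 i : 0 < norm1 (x i) by apply: norm1_gt0; case: (px i).
have xz i : norm1 (x i) <= norm1 (z i).
  have [_ [_ [k k0 ->]]] := hx i; rewrite norm1Z ler_peMl ?(ltW (nx0 i)) //.
  by rewrite -gtz0_ge1 normr_gt0.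
have sum_xz : \sum_i norm1 (x i) <= \sum_i norm1 (z i) by exact: ler_sum.
(* In dimension 0 there is no coordinate to measure, but the space is a single point and both
   zonotopes coincide. *)
have [d0|dpos] := posnP d.
  have all_eq (a b : 'rV[R]_d) : a = b.
    by apply/rowP => i; have := ltn_ord i; rewrite {2}d0.
  have -> : Z = H1 R d p.
    rewrite HE ZE; apply/seteqP; split => y _.
      by rewrite (all_eq y (corner 0 (fun j => lattice_point (h j)) finset.set0)); exact: zon_corner.
    by rewrite (all_eq y (corner (lattice_point z0) (fun i => lattice_point (z i)) finset.set0)); exact: zon_corner.
  split; rewrite ?lexx ?ltnn // => _ _; exists 0.
  by apply/seteqP; split => y hy; [exists y|case: hy => y' ? _; rewrite (all_eq y y')].
pose l := Ordinal dpos.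
have boxZ : \sum_i norm1 (z i) <= d%:Z * box_size Z by rewrite ZE sum_norm1_le_box_size.
have boxH : d%:Z * box_size (H1 R d p) = \sum_j norm1 (h j).
  have -> : H1 R d p = zon (lattice_point 0) (fun j => lattice_point (h j)).
    by rewrite HE lattice_point0.
  have [l0 -> _] := @box_size_zon R d _ 0 h l; rewrite -sum_width.
  (* All widths of [H1] are equal, so their sum is exactly [d] times the largest. *)
  rewrite (eq_bigr (fun=> width h l0)) => [|k _]; last exact: H1_widths_eq hinj hH.
  by rewrite sumr_const card_ord -mulr_natl natz.
have d0 : 0 < d%:Z by [].
rewrite dZ dH -(ler_pM2l d0) -(ltr_pM2l d0) boxH; split.
- move=> mn; apply: le_trans boxZ; apply: le_trans sum_xz.
  (* Adding [p] back for each generator turns the comparison of excesses into one of norms, as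
     [m <= n]. *)
  rewrite -[leLHS](subrK (p%:Z *+ m)) -[leRHS](subrK (p%:Z *+ n)).
  by rewrite lerD // ler_wpMn2l.
- move=> mn; apply: lt_le_trans boxZ; apply: lt_le_trans sum_xz.
  (* Here the strictness comes from the copies of [p], since [m < n] and [0 < p]. *)
  rewrite -[ltLHS](subrK (p%:Z *+ m)) -[ltRHS](subrK (p%:Z *+ n)).
  by rewrite ler_ltD // ltr_pMn2l.
move=> mn boxE.
(* Equal box sizes close the chain of inequalities from [h] through [x] to [z], so each of them is
   an equality. *)
have le1 : \sum_i norm1 (x i) <= \sum_j norm1 (h j).
  by rewrite -boxH boxE; exact: le_trans boxZ.
have {}eq_sum i : x i \in codom h by apply: eq_sum; rewrite mn lerD2r.
have sum_eq : \sum_i norm1 (x i) = \sum_i norm1 (z i).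
  apply/eqP; rewrite eq_le sum_xz /=; apply: le_trans boxZ _.
  by rewrite -boxE boxH; move: le_sum; rewrite mn lerD2r.
(* The injective families [x] and [h] have equally many members, so inclusion of the ranges is
   equality. *)
have xH : range x = H1_generators p.
  have /choice [phi hphi] i : exists j, x i = h j by have /codomP := eq_sum i.
  have [||psi _ psiK] := @inj_card_bij _ _ phi.
  - by move=> i j e; apply: xinj; rewrite !hphi e.
  - by rewrite card_ord -mn.
  rewrite -hH; apply/seteqP; split => [_ [i _ <-]|_ [j _ <-]].
    by exists (phi i).
  by exists (psi j); rewrite // hphi psiK.
have [i|b Zb] := @zon_flip R d _ (lattice_point z0) (fun i => lattice_point (z i))
    (fun i => lattice_point (x i)).
  (* Equal sums of termwise ordered norms agree term by term, so the multiplier from [x i] to [z i]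
     is 1 or -1. *)
  have /eqP : norm1 (z i) - norm1 (x i) = 0.
    have /eqP : \sum_i (norm1 (z i) - norm1 (x i)) = 0 by rewrite sumrB sum_eq subrr.
    rewrite psumr_eq0 => [/allP/(_ i (mem_index_enum _))/eqP //|k _].
    by rewrite subr_ge0.
  have [_ [_ [k k0 zk]]] := hx i; rewrite zk norm1Z -{2}[norm1 _]mul1r -mulrBl.
  rewrite mulf_eq0 (gt_eqF (nx0 i)) orbF subr_eq0.
  rewrite eqr_norml ler01 andbT => /orP[]/eqP ->.
    by left; rewrite scale1r.
  by right; rewrite scaleN1r lattice_pointN.
by exists b; rewrite ZE Zb zon_translate (H1_zon xinj xH).
Qed.
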